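(* Let $M\geq 1$ be an integer and let $(\tau,R)$ be an $M$-layer medium, with $\tau=(\tau_0,\ldots,\tau_M)$ and $R=(R_0,\ldots,R_M)$. Then \[ G^{(\tau,R)}(t)=\sum_{k\in\mathfrak{L}_M}a(R,k)\,\delta(t-\langle k,\tau\rangle), \] where for each $k\in\mathfrak{L}_M$, setting $u=\min\{\mathbb{1},\tilde{k}\}$, \[ a(R,k)=\sum_{b\in V(k)}\binom{k}{b}\binom{\tilde{k}-u}{b-u}(-R)^{\tilde{k}-b}R^{k-b}T^{2b}, \] and $V(k)$ denotes the set of $b\in\mathbb{Z}^{M+1}$ such that $u\leq b\leq\min\{k,\tilde{k}\}$.
   Context: Fix depths $z_{-1}<z_0<z_1<\cdots<z_M$. An $M$-layer medium is a pair $(\tau,R)$ with $\tau=(\tau_0,\ldots,\tau_M)$ positive reals (two-way travel times; $\tau_j/2$ is the time to traverse between $z_{j-1}$ and $z_j$) and $R=(R_0,\ldots,R_M)$ reals with $-1<R_n<1$ (reflection coefficients at $z_n$). Set $T_n=\sqrt{1-R_n^2}$ and $T=(T_0,\ldots,T_M)$. A (reflection) scattering sequence is a finite sequence $\mathsf{p}=(\mathsf{p}_0,\ldots,\mathsf{p}_L)$ with $L\geq 2$, $\mathsf{p}_0=\mathsf{p}_L=z_{-1}$, $\mathsf{p}_i\in\{z_0,\ldots,z_M\}$ for $1\le i\le L-1$, and for every $0\le i\le L-1$ there is $-1\le j\le M-1$ with $\{\mathsf{p}_i,\mathsf{p}_{i+1}\}=\{z_j,z_{j+1}\}$. Let $\mathsf{S}_M$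 be the set of these. The weight of $\mathsf{p}$ is $w(\mathsf{p})=\prod_{i=1}^{L-1}w_i$, where if $\mathsf{p}_i=z_j$: $w_i=R_j$ if $\mathsf{p}_{i-1}=\mathsf{p}_{i+1}=z_{j-1}$; $w_i=-R_j$ if $\mathsf{p}_{i-1}=\mathsf{p}_{i+1}=z_{j+1}$; $w_i=T_j$ otherwise. The arrival time of $\mathsf{p}$ is $\sigma(\mathsf{p})=\sum_{i=0}^{L-1}\tau_{j_i}/2$, where step $i$ goes between $z_{j_i-1}$ and $z_{j_i}$ ($0\le j_i\le M$). The reflection Green's function (velocity impulse response recorded at $z_{-1}$ for a downward unit plane-wave impulse started at $z_{-1}$) is $G^{(\tau,R)}(t)=\sum_{\mathsf{p}\in\mathsf{S}_M}w(\mathsf{p})\,\delta(t-\sigma(\mathsf{p}))$, terms with equal arrival times being combined. $\mathfrak{L}_M=\{(k_0,\ldots,k_M)\in\mathbb{Z}_{\ge 0}^{M+1}: k_0=1\text{ and for all }n\le M-1,\ k_n=0\Rightarrow k_{n+1}=0\}$. Vector conventions: for $k=(k_0,\ldots,k_M)$, $\tilde{k}=(k_1,\ldots,k_M,0)$; $\mathbb{1}=(1,\ldots,1)\in\mathbb{Z}^{M+1}$; $\min$ and $\le$ are entrywise; $\langle k,\tau\rangle=\sum_n k_n\tau_n$; $s^d=\prod_{n=0}^M s_n^{d_n}$ (with $0^0=1$); $\binom{x}{y}=\prod_{n=0}^M\binom{x_n}{y_n}$. *)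

(* Defs.v *)
From HB Require Import structures.
From mathcomp Require Import all_boot all_order all_algebra.
From mathcomp Require Import all_classical all_reals.
Set Implicit Arguments. Unset Strict Implicit. Unset Printing Implicit Defensive.
Import Order.TTheory GRing.Theory Num.Theory.
Local Open Scope ring_scope.

(* Depth encoding: the depth z_j (j = -1..M) is encoded by the natural number j+1,
   so z_{-1} ~ 0 and z_M ~ M+1.  Layer data tau, R are functions nat -> R whose
   values at indices 0..M are tau_0..tau_M, R_0..R_M (other values unused). *)

Definition Tc {R : realType} (Rc : nat -> R) (n : nat) : R := Num.sqrt (1 - Rc n ^+ 2).

Definition adjacent (a b : nat) : bool := (a.+1 == b) || (b.+1 == a).

Definition is_scat (M : nat) (p : seq nat) : bool :=
  [&& (3 <= size p)%N, nth 0%N p 0 == 0%N, last 0%N p == 0%N,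
      all (fun i => 0 < nth 0 p i <= M.+1)%N (iota 1 (size p - 2)) &
      all (fun i => adjacent (nth 0%N p i) (nth 0%N p i.+1)) (iota 0 (size p).-1)].

(* local weight w_i at an interior point c = p_i (= z_j with j = c-1),
   predecessor a = p_{i-1}, successor b = p_{i+1}. *)
Definition wloc {R : realType} (Rc : nat -> R) (a c b : nat) : R :=
  if (a == c.-1) && (b == c.-1) then Rc c.-1
  else if (a == c.+1) && (b == c.+1) then - Rc c.-1
  else Tc Rc c.-1.

Definition weight {R : realType} (Rc : nat -> R) (p : seq nat) : R :=
  \prod_(1 <= i < (size p).-1) wloc Rc (nth 0%N p i.-1) (nth 0%N p i) (nth 0%N p i.+1).

(* arrival time: a step between z_{q-1} and z_q (codes q and q+1) costs tau_q / 2 *)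
Definition sigma {R : realType} (tau : nat -> R) (p : seq nat) : R :=
  \sum_(0 <= i < (size p).-1) tau (minn (nth 0%N p i) (nth 0%N p i.+1)) / 2.

Definition vat (M : nat) (k : {ffun 'I_M.+1 -> nat}) (n : nat) : nat :=
  if (n < M.+1)%N then k (inord n) else 0%N.

Definition ktil (M : nat) (k : {ffun 'I_M.+1 -> nat}) : {ffun 'I_M.+1 -> nat} :=
  [ffun n : 'I_M.+1 => vat k (nat_of_ord n).+1].

Definition inL (M : nat) (k : {ffun 'I_M.+1 -> nat}) : Prop :=
  k ord0 = 1%N /\ forall n : nat, (n < M)%N -> vat k n = 0%N -> vat k n.+1 = 0%N.

Definition kdot {R : realType} (M : nat) (k : {ffun 'I_M.+1 -> nat}) (tau : nat -> R) : R :=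
  \sum_(n < M.+1) (k n)%:R * tau n.

Definition uvec (M : nat) (k : {ffun 'I_M.+1 -> nat}) : {ffun 'I_M.+1 -> nat} :=
  [ffun n => minn 1 (ktil k n)].

(* V(k) = { b : u <= b <= min(k, k~) } (such b are automatically nonnegative) *)
Definition Vset (M : nat) (k : {ffun 'I_M.+1 -> nat}) : set {ffun 'I_M.+1 -> nat} :=
  [set b | forall n : 'I_M.+1, (uvec k n <= b n <= minn (k n) (ktil k n))%N].

Definition acoef {R : realType} (M : nat) (Rc : nat -> R) (k : {ffun 'I_M.+1 -> nat}) : R :=
  \sum_(b \in Vset k)
    \prod_(n < M.+1)
      ((('C(k n, b n) * 'C(ktil k n - uvec k n, b n - uvec k n))%N)%:R
       * (- Rc n) ^+ (ktil k n - b n) * Rc n ^+ (k n - b n) * Tc Rc n ^+ (2 * b n)).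

(* Main.v *)
(* Record a path as the depth-first tour of a plane tree: each visit of the path
   to the region below z_{n-1}, from arrival at z_n to return to z_{n-1}, is a
   node at level n, and k_n, the number of nodes at level n, satisfies
   sigma(p) = <k, tau>.  A leaf at level n contributes R_n (one reflection from
   above); a node with j+1 children contributes T_n^2 (-R_n)^j (transmission
   down and up, with j reflections from below in between).  A forest is the same
   as the list of numbers of children of its roots together with the forest of
   these children, so the sum of the weights of the trees with level counts k is
   a product over n.  The n-th factor is
     sum over (c_1, ..., c_{k_n}) with c_1 + ... + c_{k_n} = k_{n+1}
   of the products of node weights; grouping by the number b of nonzero c_i
   gives 'C(k_n, b) choices of their positions and 'C(k_{n+1} - 1, b - 1) compositions
   of k_{n+1} into b positive parts. *)

Require Import Defs.
From HB Require Import structures.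
From mathcomp Require Import all_boot all_order all_algebra.
From mathcomp Require Import all_classical all_reals.
From mathcomp Require Import ring zify.
Import Order.TTheory GRing.Theory Num.Theory.
Local Open Scope ring_scope.
Local Open Scope classical_set_scope.

(** * Compositions of an integer, and those into positive parts *)

Section Compositions.
Local Open Scope nat_scope.

Fixpoint compositions (m s : nat) : seq (seq nat) :=
  if m is m'.+1 then
    [seq j :: c | j <- iota 0 s.+1, c <- compositions m' (s - j)]
  else if s is 0 then [:: [::]] else [::].

Lemma compositionsS m s : compositions m.+1 s =
  [seq j :: c | j <- iota 0 s.+1, c <- compositions m (s - j)].
Proof. by []. Qed.

Lemma mem_compositions m s c :
  (c \in compositions m s) = (size c == m) && (sumn c == s).
Proof.
elim: m s c => [|m IH] s c; first by case: s => [|s]; case: c.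
rewrite compositionsS; apply/allpairsPdep/idP => [[j [c' [jI c'I ->]]]|].
  move: jI c'I; rewrite mem_iota IH => /andP[_ js] /andP[/eqP <- /eqP sc'].
  by rewrite /= sc' subnKC ?eqxx.
case: c => [|j c] // /andP[/eqP[sc] /eqP <-].
exists j, c; split => //.
  by rewrite mem_iota add0n ltnS /= leq_addr.
by rewrite IH sc /= addKn !eqxx.
Qed.

Lemma compositions_uniq m s : uniq (compositions m s).
Proof.
elim: m s => [|m IH] s; first by case: s.
rewrite compositionsS.
apply: allpairs_uniq_dep => [|j _|[j c] [j' c'] _ _ /= [-> ->]] //.
exact: iota_uniq.
Qed.

(* The number of compositions of [s] into [b] positive parts.  For [b < u], with
   [u = minn 1 s], it differs from ['C(s - u, b - u)], where truncated
   subtraction gives 1. *)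
Definition npos (s b : nat) : nat :=
  if s is s'.+1 then (if b is b'.+1 then 'C(s', b') else 0) else b == 0.

Lemma npos_gt s b : s < b -> npos s b = 0.
Proof. by case: s b => [|s] [|b] //= sb; rewrite bin_small. Qed.

(** Splitting off one part of size [s - i] from a composition of [s] leaves [i] in [b] positive
    parts. *)
Lemma sum_npos s b : \sum_(i < s) npos i b = npos s b.+1.
Proof.
elim: s => [|s IH]; first by rewrite big_ord0.
rewrite big_ord_recr /= IH; case: s {IH} => [|s] /=; first by case: b.
by case: b => [|b] /=; rewrite ?bin0 // binS.
Qed.

End Compositions.

(** * The factor of a single level as a weighted sum over compositions *)

Section CompositionSum.
Variable R : comNzRingType.
Variables r t : R.

Definition node_weight (c : nat) : R :=
  if c is c'.+1 then t ^+ 2 * (- r) ^+ c' else r.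

(** Letting [b] run over all of [0..m], with [npos] killing the inadmissible terms, gives a clean
    recursion in [m]. *)
Definition level_sum (m s : nat) : R :=
  \sum_(b < m.+1) ('C(m, b) * npos s b)%N%:R
     * (- r) ^+ (s - b) * r ^+ (m - b) * t ^+ (2 * b).

Lemma level_sum0 m : level_sum m 0 = r ^+ m.
Proof.
rewrite /level_sum big_ord_recl big1 ?addr0 => [|b _].
  by rewrite /= bin0 !subn0 muln0 !expr0 !mul1r mulr1.
by rewrite /= muln0 !mul0r.
Qed.

Lemma npos_conv s b :
  (npos s b.+1)%:R * (- r) ^+ (s - b.+1) =
  \sum_(i < s) (- r) ^+ (s - i).-1 * ((npos i b)%:R * (- r) ^+ (i - b)) :> R.
Proof.
rewrite -sum_npos natr_sum mulr_suml; apply: eq_bigr => i _.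
have [bi|ib] := leqP b i; last by rewrite npos_gt // !mul0r mulr0.
rewrite mulrCA -exprD; congr (_ * _ ^+ _).
have := ltn_ord i; lia.
Qed.

(** Recursion on the first node: a leaf gives [r], while a node with [s - i] children leaves [i] to
    the other [m] nodes. Pascal's rule separates the two cases. *)
Lemma level_sumS m s : level_sum m.+1 s =
  r * level_sum m s + \sum_(i < s) t ^+ 2 * (- r) ^+ (s - i).-1 * level_sum m i.
Proof.
rewrite /level_sum big_ord_recl /= bin0 !mul1n subn0 muln0.
under eq_bigr => b _ do rewrite /bump /= add1n binS mulnDl natrD !mulrDl subSS.
rewrite big_split /= addrA; congr (_ + _).
  rewrite [in LHS]big_ord_recr /= bin_small // !mul0r addr0.
  rewrite [in RHS]big_ord_recl /= mulrDr bin0 mul1n !subn0 muln0; congr (_ + _).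
    by rewrite exprS; ring.
  rewrite mulr_sumr; apply: eq_bigr => b _; rewrite /bump /= add1n.
  rewrite (_ : m - b = (m - b.+1).+1)%N ?exprS; first by ring.
  by have := ltn_ord b; lia.
under [in RHS]eq_bigr => i _ do rewrite mulr_sumr.
rewrite exchange_big /=; apply: eq_bigr => b _.
rewrite natrM -[X in X * _ * _]mulrA npos_conv mulr_sumr !mulr_suml.
by apply: eq_bigr => i _; rewrite natrM mulnS exprD; ring.
Qed.

Lemma sum_compositions m s :
  \sum_(c <- compositions m s) \prod_(j <- c) node_weight j = level_sum m s.
Proof.
elim: m s => [|m IH] s.
  rewrite /level_sum big_ord1 /= bin0 mul1n muln0 !subn0 !expr0 !mulr1.
  by case: s => [|s] /=; rewrite ?big_seq1 big_nil ?mul0r ?mul1r.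
rewrite compositionsS big_allpairs_dep.
under eq_bigr => j _ do under eq_bigr => c _ do rewrite big_cons.
under eq_bigr => j _ do rewrite -mulr_sumr IH.
rewrite (_ : iota 0 s.+1 = index_iota 0 s.+1) // big_mkord big_ord_recl /=.
rewrite subn0 level_sumS; congr (_ + _).
(* Passes from the number of children of the first node to the number [i] left to the others. *)
rewrite (reindex_inj rev_ord_inj) /=; apply: eq_bigr => i _.
rewrite /bump /= add1n; have := ltn_ord i => si.
by congr (_ * _ ^+ _ * level_sum _ _); lia.
Qed.

(** Recovers the summand of [acoef]: [npos] vanishes at each excluded [b] and equals the truncated
    binomial at the others. *)
Lemma level_sumE m s : level_sum m s =
  \sum_(b < m.+1 | (minn 1 s <= b <= minn m s)%N)
    ('C(m, b) * 'C(s - minn 1 s, b - minn 1 s))%N%:R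
     * (- r) ^+ (s - b) * r ^+ (m - b) * t ^+ (2 * b).
Proof.
rewrite /level_sum [RHS]big_mkcond; apply: eq_bigr => b _ /=.
have bm : (b <= m)%N by rewrite -ltnS.
rewrite leq_min bm /=; case: s => [|s].
  by case: (nat_of_ord b) bm => [|b'] bm; rewrite //= muln0 !mul0r.
rewrite (_ : minn 1 s.+1 = 1%N); last by rewrite minnE; lia.
case: (nat_of_ord b) bm => [|b'] bm; first by rewrite //= muln0 !mul0r.
rewrite /= !subn1 /= ltnS; case: leqP => // sb'.
by rewrite (bin_small sb') muln0 !mul0r.
Qed.

End CompositionSum.

(* Plane trees of height at most [d]: a tree is the list of its subtrees, which
   makes [flatten] the passage from a forest to the forest of the children. *)
Fixpoint tree (d : nat) : eqType :=
  if d is d'.+1 then seq (tree d') : eqType else unit.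

(** * Level counts of plane forests, and the forests with given counts *)

Section Profiles.
Local Open Scope nat_scope.

Fixpoint prof (d : nat) : seq (tree d) -> nat -> nat :=
  match d with
  | 0 => fun f n => if n is 0 then size f else 0
  | d'.+1 => fun f n =>
      if n is n'.+1 then prof d' (flatten f) n' else size f
  end.

Lemma prof0 d (f : seq (tree d)) : prof d f 0 = size f.
Proof. by case: d f. Qed.

Lemma prof_nil d n : prof d [::] n = 0.
Proof. by elim: d n => [|d IH] [|n] //=. Qed.

Lemma prof_cat d (f g : seq (tree d)) n :
  prof d (f ++ g) n = prof d f n + prof d g n.
Proof.
by elim: d f g n => [|d IH] f g [|n] //=; rewrite ?size_cat // flatten_cat IH.
Qed.

Lemma prof_gt d (f : seq (tree d)) n : d < n -> prof d f n = 0.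
Proof. by elim: d f n => [|d IH] f [|n] //= dn; apply: IH. Qed.

(** An empty level has no children; this is the condition on [k] in [inL]. *)
Lemma prof_eq0 d (f : seq (tree d)) n : prof d f n = 0 -> prof d f n.+1 = 0.
Proof.
elim: d f n => [|d IH] f [|n] //=; last exact: IH.
by move/size0nil => ->; rewrite prof_nil.
Qed.

(** [reshape c g] deals the forest [g] out to roots with child counts [c]; [shape] and [flatten]
    recover [c] and [g]. *)
Fixpoint forests (d : nat) (k : nat -> nat) : seq (seq (tree d)) :=
  match d with
  | 0 => [:: nseq (k 0) tt]
  | d'.+1 =>
      [seq reshape c g | c <- compositions (k 0) (k 1),
                         g <- forests d' (fun n => k n.+1)]
  end.

Lemma forestsS d k : forests d.+1 k =
  [seq (reshape c g : seq (tree d.+1)) | c <- compositions (k 0) (k 1),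
                         g <- forests d (fun n => k n.+1)].
Proof. by []. Qed.

Lemma mem_forests d k f : (forall n, d < n -> k n = 0) ->
  f \in forests d k <-> prof d f =1 k.
Proof.
elim: d k f => [|d IH] k f k0.
  rewrite inE; split=> [/eqP -> [|n] | fk].
  - by rewrite /= size_nseq.
  - by rewrite /= k0.
  - have := fk 0 => /= <-; apply/eqP.
    by elim: f {fk} => [//|[] f IH] /=; rewrite -IH.
have k0' n : d < n -> k n.+1 = 0 by move=> dn; apply: k0.
have sum_shape c g : c \in compositions (k 0) (k 1) ->
    g \in forests d (fun n => k n.+1) -> size g = sumn c.
  rewrite mem_compositions => /andP[_ /eqP ->].
  by move/(IH _ _ k0') => /(_ 0); rewrite prof0.
rewrite forestsS; split=> [/allpairsP[[c g] /= [cI gI ->]] | fk].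
  have gc := sum_shape _ _ cI gI.
  move: cI gI; rewrite mem_compositions => /andP[/eqP sc _] /(IH _ _ k0') gk.
  case=> [|n] /=; first by rewrite size_reshape.
  by rewrite reshapeKr ?gc // gk.
apply/allpairsP; exists (shape f, flatten f); split => /=.
- rewrite mem_compositions size_map -size_flatten -(fk 0) -(fk 1) /= prof0.
  by rewrite !eqxx.
- by apply/(IH _ _ k0') => n; rewrite -(fk n.+1).
- by rewrite flattenK.
Qed.

Lemma forests_uniq d k : (forall n, d < n -> k n = 0) -> uniq (forests d k).
Proof.
elim: d k => [|d IH] k k0 //.
have k0' n : d < n -> k n.+1 = 0 by move=> dn; apply: k0.
rewrite forestsS; apply: allpairs_uniq; rewrite ?compositions_uniq ?IH //.
have K c g : c \in compositions (k 0) (k 1) ->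
    g \in forests d (fun n => k n.+1) ->
    shape (reshape c g) = c /\ flatten (reshape c g) = g.
  rewrite mem_compositions => /andP[_ /eqP cs].
  move/(mem_forests _ _ _ k0') => /(_ 0); rewrite prof0 => gs.
  by rewrite reshapeKl ?reshapeKr ?cs ?gs.
move=> _ _ /allpairsP[[c g] /= [cI gI ->]] /allpairsP[[c' g'] /= [cI' gI' ->]].
move=> /= e; have [sc fg] := K _ _ cI gI; have [sc' fg'] := K _ _ cI' gI'.
by congr (_, _); [rewrite -sc -sc' e | rewrite -fg -fg' e].
Qed.

End Profiles.

(** * Weights of forests *)

Section ForestWeights.
Variables (R : comNzRingType) (r t : nat -> R).

(** [l] is the level of the roots, which selects the interface. At [d = 0] every node is a leaf. *)
Fixpoint fweight (d l : nat) : seq (tree d) -> R :=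
  match d with
  | 0 => fun f => r l ^+ size f
  | d'.+1 => fun f =>
      \prod_(x <- f) node_weight _ (r l) (t l) (size (x : seq (tree d')))
        * fweight d' l.+1 (flatten f)
  end.

Lemma fweight_nil d l : fweight d l [::] = 1.
Proof. by elim: d l => [|d IH] l //=; rewrite big_nil mul1r IH. Qed.

Lemma fweight_cat d l (f g : seq (tree d)) :
  fweight d l (f ++ g) = fweight d l f * fweight d l g.
Proof.
elim: d l f g => [|d IH] l f g /=; first by rewrite size_cat exprD.
by rewrite big_cat flatten_cat IH mulrACA.
Qed.

(** The root weights depend only on [c], the remaining weight only on [g], and the range of [g] is
    the same for every [c], so the sum factors. *)
Lemma sum_forests d l k : (forall n, (d < n)%N -> k n = 0%N) ->
  \sum_(f <- forests d k) fweight d l f =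
  \prod_(n < d.+1) level_sum R (r (l + n)%N) (t (l + n)%N) (k n) (k n.+1).
Proof.
elim: d l k => [|d IH] l k k0.
  by rewrite big_seq1 big_ord1 /= size_nseq addn0 (k0 1%N) // level_sum0.
have k0' n : (d < n)%N -> k n.+1 = 0%N by move=> dn; apply: k0.
rewrite big_ord_recl addn0.
under [in RHS]eq_bigr => i _ do rewrite lift0 addnS -addSn.
rewrite -sum_compositions -(IH l.+1 (fun n => k n.+1)) // forestsS.
rewrite big_allpairs_dep mulr_suml.
rewrite big_seq [RHS]big_seq; apply: eq_bigr => c.
rewrite mem_compositions => /andP[_ /eqP cs].
rewrite mulr_sumr big_seq [RHS]big_seq; apply: eq_bigr => g.
move=> /(mem_forests _ _ _ k0') /(_ 0%N); rewrite prof0 => gs.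
rewrite /= reshapeKr ?gs ?cs //; congr (_ * _).
by rewrite -[in RHS](@reshapeKl _ c g) ?gs ?cs // big_map.
Qed.

End ForestWeights.

(** * Scattering sequences as depth-first tours *)

Section Tours.
Local Open Scope nat_scope.

(* The depth-first tour of a tree rooted at depth [c], without its initial
   visit to the root. *)
Fixpoint tour (d c : nat) : tree d -> seq nat :=
  match d with
  | 0 => fun _ => [::]
  | d'.+1 => fun f => flatten [seq c.+1 :: rcons (tour d' c.+1 x) c | x <- f]
  end.

Lemma tour_cons d c x f : tour d.+1 c (x :: f) =
  c.+1 :: tour d c.+1 x ++ c :: tour d.+1 c f.
Proof. by rewrite /= cat_rcons. Qed.

Lemma last_tour d c x : last c (tour d c x) = c.
Proof.
elim: d c x => [//|d IH] c; elim=> [//|x f IHf].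
by rewrite tour_cons /= last_cat.
Qed.

Lemma path_tour d c x : path adjacent c (tour d c x).
Proof.
elim: d c x => [//|d IH] c; elim=> [//|x f IHf].
rewrite tour_cons /= cat_path IH last_tour /= IHf.
by rewrite /adjacent !eqxx orbT.
Qed.

Lemma tour_bounds d c x : all (fun i => c <= i <= c + d) (tour d c x).
Proof.
elim: d c x => [//|d IH] c; elim=> [//|x f IHf].
rewrite tour_cons /= all_cat /= IHf.
have /sub_all -> // : subpred (fun i => c.+1 <= i <= c.+1 + d)
  (fun i => c <= i <= c + d.+1) by move=> i; lia.
by lia.
Qed.

Lemma notin_tour d c x : c \notin tour d c.+1 x.
Proof. by apply/negP => /(allP (tour_bounds d c.+1 x)); lia. Qed.

Lemma cat_cons_inj (T : eqType) (a : T) s1 s2 t1 t2 :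
  a \notin s1 -> a \notin t1 -> s1 ++ a :: s2 = t1 ++ a :: t2 ->
  s1 = t1 /\ s2 = t2.
Proof.
elim: s1 t1 => [|x s1 IH] [|y t1] //=.
- by move=> _ _ [].
- by rewrite inE negb_or => _ /andP[/eqP ay _] [].
- by rewrite inE negb_or => /andP[/eqP ax _] _ [/esym].
rewrite !inE !negb_or => /andP[_ s1a] /andP[_ t1a] [-> e].
by have [-> ->] := IH _ s1a t1a e.
Qed.

(** The tour of the first subtree stays deeper than [c], so the first [c] marks its end. *)
Lemma tour_inj d c : injective (tour d c).
Proof.
elim: d c => [|d IH] c; first by case=> -[].
elim=> [|x f IHf] [|y g] //; rewrite !tour_cons => -[].
move/cat_cons_inj => /(_ (notin_tour _ _ _) (notin_tour _ _ _)) [xy fg].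
by rewrite (IH _ _ _ xy) (IHf _ fg).
Qed.

(* Cut the walk at its first return to [c]. *)
Lemma tour_surj d c q : path adjacent c q -> last c q = c ->
  all (fun i => c <= i <= c + d) q -> exists x, q = tour d c x.
Proof.
(* Strong induction on the length, for all [d] and [c]: the piece before the return is based at
   [c.+1], the piece after it at [c]. *)
have [n] := ubnP (size q); elim: n q d c => // n IH [|y q] d c.
  by move=> _ _ _ _; case: d => [|d]; [exists tt | exists [::]].
rewrite /= ltnS => qn /andP[cy yq] lq /andP[/andP[yc ycd] qb].
have yE : y = c.+1 by move: cy; rewrite /adjacent => /orP[] /eqP; lia.
case: d ycd qb => [|d] ycd qb; first by lia.
have cq : has (pred1 c) q.
  rewrite has_pred1; have := mem_last y q.
  by rewrite lq inE yE => /orP[/eqP|//]; lia.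
subst y; case/split_find: cq qn yq lq qb => z q1 q2 /eqP -> {z} nq1.
rewrite cat_rcons size_cat cat_path /= all_cat /= last_cat /=.
move=> qn /and3P[p1 a1 p2] lq /and3P[b1 _ b2].
have cq1 : c \notin q1 by rewrite -has_pred1.
have b1' : all (fun i => c.+1 <= i <= c.+1 + d) q1.
  apply/allP => i iq1; have := allP b1 i iq1.
  by have /eqP : i != c by [apply: contraNneq cq1 => <-]; lia.
(* The point just before the return is adjacent to [c] and deeper than it. *)
have l1 : last c.+1 q1 = c.+1.
  have /andP[] : c.+1 <= last c.+1 q1 <= c.+1 + d.
    by have := mem_last c.+1 q1; rewrite inE => /orP[/eqP->|/(allP b1')//]; lia.
  by move: a1; rewrite /adjacent => /orP[]/eqP; lia.
have [|x ->] := IH q1 d c.+1 _ p1 l1 b1'; first by lia.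
have [|f ->] := IH q2 d.+1 c _ p2 lq b2; first by lia.
by exists (x :: f); rewrite -tour_cons.
Qed.

Lemma is_scatE M p : is_scat M p <->
  exists q, [/\ p = 0 :: rcons q 0, q != [::],
               all (fun i => 0 < i <= M.+1) q & path adjacent 0 (rcons q 0)].
Proof.
split=> [/and5P[] | [q [-> q0 qb qp]]].
  case: p => [//|a p] /=; case/lastP: p => [//|q b] /=.
  rewrite size_rcons !ltnS last_rcons => q0 /eqP -> {a} /eqP -> {b} qb qp.
  exists q; split=> //; first by case: (q) q0.
    apply/(all_nthP 0) => i iq; have := allP qb i.+1.
    rewrite mem_iota /= nth_rcons iq; apply; lia.
  apply/(pathP 0) => i; rewrite size_rcons => iq.
  by apply: (allP qp i); rewrite mem_iota.
have q_gt0 : 0 < size q by rewrite lt0n size_eq0.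
have szp : size (0 :: rcons q 0) = (size q).+2 by rewrite /= size_rcons.
apply/and5P; split; rewrite ?szp //.
- by rewrite /= last_rcons.
- apply/allP => -[|i]; rewrite mem_iota // => iq.
  have {}iq : i < size q by lia.
  by rewrite /= nth_rcons iq; apply: (allP qb); rewrite mem_nth.
- apply/allP => i; rewrite mem_iota => iq.
  by apply: (pathP 0 qp); rewrite size_rcons.
Qed.

(** Interior points are positive, so the only return to 0 is the last point: the root at depth 0 has
    exactly one child [x]. *)
Lemma is_scat_tour M p :
  is_scat M p <-> exists x : tree M, p = 0 :: tour M.+1 0 [:: x].
Proof.
rewrite is_scatE; split=> [[q [-> q0 qb]] | [x ->]].
  case: q q0 qb => // y q _ /= /andP[yb qb] /andP[y1].
  have {y1 yb} -> : y = 1 by move: y1; rewrite /adjacent; lia.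
  rewrite rcons_path => /andP[qp]; rewrite /adjacent /= => ql.
  have [] := tour_surj M 1 q qp.
  - by move: ql; lia.
  - by apply/allP => i /(allP qb); lia.
  by move=> x ->; exists x; rewrite cats0.
exists (1 :: tour M 1 x); split=> //.
- by rewrite /= cats0.
- apply/allP => i; rewrite inE => /orP[/eqP->//|].
  by move/(allP (tour_bounds M 1 x)); lia.
by have := path_tour M.+1 0 [:: x]; rewrite /= cats0.
Qed.

End Tours.

(** * Weight and arrival time of a tour *)

Section TourWeights.
Variables (R : realType).

Lemma weight2 (Rc : nat -> R) a b : weight Rc [:: a; b] = 1.
Proof. by rewrite /weight big_geq. Qed.

Lemma weight_cons (Rc : nat -> R) a b c s :
  weight Rc [:: a, b, c & s] = wloc Rc a b c * weight Rc [:: b, c & s].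
Proof. rewrite /weight /= big_ltn //= big_add1 /=; congr (_ * _).
by apply: eq_big_nat => -[]. Qed.

(** Local weights involve three consecutive points, so an overlap of two points puts each triple in
    exactly one piece. *)
Lemma weight_cat (Rc : nat -> R) s1 x y s2 :
  weight Rc (s1 ++ [:: x, y & s2]) =
  weight Rc (s1 ++ [:: x; y]) * weight Rc [:: x, y & s2].
Proof.
elim: s1 => [|a s1 IH]; first by rewrite weight2 mul1r.
by case: s1 IH => [|b [|c s1]] /= IH; rewrite !(weight_cons _ a) -mulrA -IH.
Qed.

Lemma weight_split (Rc : nat -> R) d a c x s :
  weight Rc [:: a, c & tour d c x ++ a :: s] =
  weight Rc (a :: c :: rcons (tour d c x) a) * weight Rc [:: c, a & s].
Proof.
have [q qE] : exists q, c :: tour d c x = rcons q c.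
  by exists (belast c (tour d c x)); rewrite lastI last_tour.
rewrite -(cat_cons c) -(rcons_cons c) qE cat_rcons -(cat_cons a) weight_cat.
by rewrite -[rcons (rcons q c) a]cats1 cat_rcons.
Qed.

(** At [z_c], coded [c.+1]: reflection from above, reflection from below, transmission down,
    transmission up. *)
Lemma wlocE (Rc : nat -> R) c :
  [/\ wloc Rc c c.+1 c = Rc c, wloc Rc c.+2 c.+1 c.+2 = - Rc c,
      wloc Rc c c.+1 c.+2 = Tc Rc c & wloc Rc c.+2 c.+1 c = Tc Rc c].
Proof.
have c2 : (c.+2 == c) = false by lia.
have c2' : (c == c.+2) = false by lia.
by rewrite /wloc /= !eqxx c2 c2' /= ?andbF.
Qed.

Lemma weight_tour (Rc : nat -> R) d c (x : tree d) :
  weight Rc (c :: c.+1 :: rcons (tour d c.+1 x) c) =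
  fweight R Rc (Tc Rc) d c [:: x].
Proof.
elim: d c x => [|d IH] c x; have [wT wB wD wU] := wlocE Rc c.
  by rewrite /= weight_cons weight2 mulr1.
(* The walk has just come up from a child: each remaining child costs one reflection from below, and
   the final exit one transmission up. *)
have wf (f : seq (tree d)) :
    weight Rc (c.+2 :: c.+1 :: rcons (tour d.+1 c.+1 f) c) =
    Tc Rc c * (- Rc c) ^+ size f * fweight R Rc (Tc Rc) d c.+1 f.
  elim: f => [|y f IHf].
    by rewrite /= weight_cons weight2 fweight_nil wU !mulr1.
  rewrite tour_cons rcons_cons rcons_cat rcons_cons weight_cons weight_split IH.
  by rewrite IHf -[y :: f]cat1s fweight_cat wB exprS; ring.
case: x => [|y f].
  by rewrite /= weight_cons weight2 big_seq1 /= fweight_nil !mulr1.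
rewrite tour_cons rcons_cons rcons_cat rcons_cons weight_cons weight_split IH.
rewrite wf [RHS]/= big_seq1 /= cats0 -[y :: f]cat1s fweight_cat wD.
by ring.
Qed.

Variable tau : nat -> R.

Lemma sigma1 a : sigma tau [:: a] = 0.
Proof. by rewrite /sigma big_geq. Qed.

Lemma sigma_cons a b s :
  sigma tau [:: a, b & s] = tau (minn a b) / 2 + sigma tau (b :: s).
Proof. by rewrite /sigma /= big_ltn //= big_add1. Qed.

Lemma sigma_cat s1 x s2 :
  sigma tau (s1 ++ x :: s2) = sigma tau (rcons s1 x) + sigma tau (x :: s2).
Proof.
elim: s1 => [|a s1 IH]; first by rewrite sigma1 add0r.
by case: s1 IH => [|b s1] /= IH; rewrite !(sigma_cons a) -addrA -IH.
Qed.

Lemma sigma_rcons a s b :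
  sigma tau (rcons (a :: s) b) =
  sigma tau (a :: s) + tau (minn (last a s) b) / 2.
Proof.
elim: s a => [|x s IH] a; first by rewrite sigma_cons !sigma1 addrC.
by rewrite !rcons_cons !sigma_cons -rcons_cons IH addrA.
Qed.

(** Each node of [f] accounts for one step down and one step up, each of half the travel time of its
    layer. *)
Lemma sigma_tour d c f :
  sigma tau (c :: tour d.+1 c f) =
  \sum_(n < d.+1) (prof d f n)%:R * tau (c + n)%N.
Proof.
elim: d c f => [|d IH] c.
  elim=> [|x f IHf]; first by rewrite sigma1 big_ord1 mul0r.
  rewrite tour_cons !sigma_cons IHf !big_ord1 /= addn0 minnC.
  by rewrite (minn_idPr (leqnSn c)) -[(size f).+1]addn1 natrD; field.
elim=> [|x f IHf].
  by rewrite sigma1 big1 // => n _; rewrite prof_nil mul0r.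
rewrite tour_cons sigma_cons -cat_cons sigma_cat sigma_rcons IHf IH last_tour.
under [in RHS]eq_bigr => n _ do rewrite -cat1s prof_cat natrD mulrDl.
rewrite big_split /= !addrA; congr (_ + _).
rewrite [in RHS]big_ord_recl mul1r addn0 (minnC c) !(minn_idPr (leqnSn c)).
under [in RHS]eq_bigr => n _ do rewrite lift0 cats0 addnS -addSn.
by field.
Qed.

End TourWeights.

(** * Product form of [a(R,k)], and finiteness at a fixed time *)

Section MainProof.
Variables (R : realType) (M : nat).
Implicit Types k : {ffun 'I_M.+1 -> nat}.

Lemma vat_ord k (n : 'I_M.+1) : vat k n = k n.
Proof. by rewrite /vat ltn_ord inord_val. Qed.

Lemma vat_gt k n : (M < n)%N -> vat k n = 0%N.
Proof. by move=> nM; rewrite /vat ltnNge nM. Qed.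

Lemma acoefE (Rc : nat -> R) k : acoef Rc k =
  \prod_(n < M.+1) level_sum R (Rc n) (Tc Rc n) (vat k n) (vat k n.+1).
Proof.
(* A common bound puts all entries of [b] in one finite type, as needed to exchange sum and
   product. *)
pose K := (\max_n k n)%N.
have kK n : (k n <= K)%N by apply: leq_bigmax.
pose P (n : 'I_M.+1) (b : nat) := (uvec k n <= b <= minn (k n) (ktil k n))%N.
pose Q (n : 'I_M.+1) (b : 'I_K.+1) := P n b.
pose h (g : {ffun 'I_M.+1 -> 'I_K.+1}) := [ffun n => nat_of_ord (g n)].
have h_inj : injective h.
  move=> g g' /ffunP e; apply/ffunP => n; apply/val_inj.
  by have := e n; rewrite !ffunE.
have VE : Vset k = [set` [seq h g | g <- enum (family Q)]].
  apply/seteqP; split => b /= => [bV|/mapP[g]].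
    apply/mapP; exists [ffun n => inord (b n)].
      rewrite mem_enum; apply/familyP => n; rewrite ffunE unfold_in.
      have := bV n; rewrite leq_min => /and3P[u_b bk bkt].
      by rewrite /Q /P inordK ?u_b ?leq_min ?bk // ltnS (leq_trans bk).
    apply/ffunP => n; rewrite !ffunE inordK // ltnS.
    by have := bV n; rewrite leq_min => /and3P[_ bk _]; apply: leq_trans bk _.
  by rewrite mem_enum => /familyP gQ -> n; have := gQ n; rewrite unfold_in /Q /P !ffunE.
rewrite /acoef VE -fsbig_seq ?map_inj_uniq ?enum_uniq // big_map big_enum /=.
under eq_bigr => g _ do under eq_bigr => n _ do rewrite ffunE.
pose F (n : 'I_M.+1) (b : nat) : R :=
  (('C(k n, b) * 'C(ktil k n - uvec k n, b - uvec k n))%N)%:R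
   * (- Rc n) ^+ (ktil k n - b) * Rc n ^+ (k n - b) * Tc Rc n ^+ (2 * b).
rewrite -(bigA_distr_big_dep Q (fun n b => F n b)) /=; apply: eq_bigr => n _.
rewrite level_sumE vat_ord.
transitivity (\sum_(b < (k n).+1 | P n b) F n b); last first.
  by apply: eq_big => b *; rewrite /P /F !ffunE.
rewrite [RHS](big_ord_widen_cond K.+1 (P n) (F n)) ?ltnS //.
apply: eq_bigl => b.
by rewrite /Q /P leq_min ltnS; case: (leqP b (k n)) => _; rewrite ?andbF ?andbT.
Qed.

(** All terms of [<k, tau>] are nonnegative, so each [k n] is at most [s / tau n]. *)
Lemma finite_kdot (tau : nat -> R) (s : R) :
  (forall n, (n <= M)%N -> 0 < tau n) ->
  finite_set [set k : {ffun 'I_M.+1 -> nat} | kdot k tau = s].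
Proof.
move=> tau_gt0.
have [B Bs] : exists B : nat, forall n : 'I_M.+1, s / tau n < B%:R.
  pose B n := (Num.bound `|s / tau n|).
  exists (\max_(n < M.+1) B n)%N => n.
  apply: (@lt_le_trans _ _ (B n)%:R); last first.
    by rewrite ler_nat; apply: (leq_bigmax n).
  exact: le_lt_trans (ler_norm _) (archi_boundP (normr_ge0 _)).
pose h (g : {ffun 'I_M.+1 -> 'I_B.+1}) := [ffun n => nat_of_ord (g n)].
apply: (@sub_finite_set _ _ (h @` setT)); last exact/finite_image/finite_finset.
move=> k /= ks; exists [ffun n => inord (k n)] => //.
apply/ffunP => n; rewrite !ffunE inordK // ltnS -(ler_nat R).
have tn : 0 < tau n by rewrite tau_gt0 // -ltnS.
apply/ltW/(le_lt_trans _ (Bs n)).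
rewrite ler_pdivlMr // -ks /kdot (bigD1 n) //=.
rewrite lerDl sumr_ge0 // => i _; rewrite mulr_ge0 // ltW // tau_gt0 //.
by rewrite -ltnS.
Qed.

End MainProof.

(* Coefficient of delta(t - s) in G^{(tau,R)} equals the coefficient of delta(t - s)
   in sum_{k in L_M} a(R,k) delta(t - <k,tau>), for every time s. *)
Theorem theorem1 (R : realType) (M : nat) (tau Rc : nat -> R) :
  (1 <= M)%N ->
  (forall n : nat, (n <= M)%N -> 0 < tau n) ->
  (forall n : nat, (n <= M)%N -> -1 < Rc n < 1) ->
  forall s : R,
    finite_set [set p : seq nat | is_scat M p /\ sigma tau p = s] /\
    finite_set [set k : {ffun 'I_M.+1 -> nat} | inL k /\ kdot k tau = s] /\
    \sum_(p \in [set p : seq nat | is_scat M p /\ sigma tau p = s]) weight Rc p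
    = \sum_(k \in [set k : {ffun 'I_M.+1 -> nat} | inL k /\ kdot k tau = s]) acoef Rc k.
Proof.
move=> _ tau_gt0 _ s.
have kfin : finite_set [set k : {ffun 'I_M.+1 -> nat} | inL k /\ kdot k tau = s].
  by apply: sub_finite_set (finite_kdot _ _ tau s tau_gt0) => k [].
have [ks0 ks0E] := (finite_seqP _).1 kfin.
pose ks := undup ks0; have ks_uniq : uniq ks by apply: undup_uniq.
have ksE : [set k : {ffun 'I_M.+1 -> nat} | inL k /\ kdot k tau = s] = [set` ks].
  by rewrite ks0E; apply/seteqP; split=> k /=; rewrite mem_undup.
have ksP k : k \in ks <-> inL k /\ kdot k tau = s.
  by have := congr1 (@^~ k) ksE => /= ->.
have matP (k : {ffun 'I_M.+1 -> nat}) (f : seq (tree M)) : f \in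
    forests M (vat k) <-> prof M f =1 vat k.
  by apply: mem_forests => n; apply: vat_gt.
pose path_of (f : seq (tree M)) := 0%N :: tour M.+1 0 f.
(* The sequences arriving at time [s], grouped by level counts. *)
pose ps := [seq path_of f | k <- ks, f <- forests M (vat k)].
have ps_uniq : uniq ps.
  apply: allpairs_uniq_dep => //.
    by move=> k _; apply: forests_uniq => n; apply: vat_gt.
  move=> _ _ /allpairsPdep[k [f [_ fk ->]]] /allpairsPdep[k' [f' [_ fk' ->]]].
  move=> [/(@tour_inj M.+1) ff']; subst f'.
  have -> // : k = k'.
  apply/ffunP => n; rewrite -!vat_ord.
  by rewrite -((matP _ _).1 fk) -((matP _ _).1 fk').
(* The condition [k_0 = 1] makes the forest a single tree. *)
have root k f : k \in ks -> f \in forests M (vat k) -> exists x, f = [:: x].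
  move=> /ksP[[k0 _] _] /matP/(_ 0%N); rewrite prof0 (vat_ord _ _ ord0) k0.
  by case: f => [|x []] //; exists x.
have psE : [set p : seq nat | is_scat M p /\ sigma tau p = s] = [set` ps].
  apply/seteqP; split => p /=.
    move=> [/is_scat_tour[x ->] sE].
    (* The level counts of the tree supply the witness. *)
    pose k : {ffun 'I_M.+1 -> nat} := [ffun n => prof M [:: x] (nat_of_ord n)].
    have vk : prof M [:: x] =1 vat k.
      move=> n; rewrite /vat; case: ltnP => [nM|]; last exact: prof_gt.
      by rewrite ffunE inordK.
    apply/(@allpairsPdep _ (fun=> seq (tree M))); exists k, [:: x].
    split=> //; last exact/matP.
    apply/ksP; split; last first.
      by rewrite -sE sigma_tour; apply: eq_bigr => n _; rewrite ffunE.
    split=> [|n _]; first by rewrite ffunE prof0.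
    by rewrite -!vk; apply: prof_eq0.
  move=> /(@allpairsPdep _ (fun=> seq (tree M)))[k [f [kks fk ->]]].
  split; first by have [x ->] := root _ _ kks fk; apply/is_scat_tour; exists x.
  have /ksP[_ <-] := kks; rewrite /path_of sigma_tour.
  by apply: eq_bigr => n _; rewrite ((matP _ _).1 fk) vat_ord.
split; first by rewrite psE; apply/finite_seqP; exists ps.
split=> //; rewrite psE ksE -!fsbig_seq // big_allpairs_dep.
rewrite big_seq [RHS]big_seq; apply: eq_bigr => k kks.
rewrite acoefE; rewrite -(sum_forests R Rc (Tc Rc) M 0); last exact: vat_gt.
rewrite big_seq [RHS]big_seq; apply: eq_bigr => f fk.
have [x ->] := root _ _ kks fk.
by rewrite -weight_tour /path_of /= cats0.
Qed.
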